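(* Let $R$ be a ring and $G$ a non-trivial group. (1) If the group ring $RG$ is a $U\sqrt{\Delta}$-ring, then $R$ is a $U\sqrt{\Delta}$-ring and $G$ is a $p$-group for some prime $p$ with $p\in J(R)$. (2) If $R$ is a $U\sqrt{\Delta}$-ring and $G$ is a locally finite $p$-group for some prime $p$ with $p\in J(R)$, then $RG$ is a $U\sqrt{\Delta}$-ring.
   Context: All rings are associative with identity $1\ne 0$. $J(R)$ is the Jacobson radical; ''$p\in J(R)$'' means $p\cdot 1_R\in J(R)$. A $p$-group is a group in which every element has order a power of $p$. A group is locally finite if every finitely generated subgroup is finite. For a ring $R$, $U(R)$ is its group of units, $\Delta(R)=\{x\in R \mid x+u\in U(R)\text{ for all }u\in U(R)\}$, and $\sqrt{\Delta(R)}=\{x\in R\mid x^n\in\Delta(R)\text{ for some integer }n\ge 1\}$. A ring $R$ is a $U\sqrt{\Delta}$-ring if every non-unit $a\in R$ can be written as $a=ub$ with $u\in U(R)$ and $b\in\sqrt{\Delta(R)}$. *)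

(* Defs.v *)
From HB Require Import structures.
From mathcomp Require Import all_boot all_algebra.
From mathcomp Require Import classical_sets cardinality.
From mathcomp Require Import finmap.
From mathcomp Require Import monalg.

Set Implicit Arguments.
Unset Strict Implicit.
Unset Printing Implicit Defensive.

Import GRing.Theory.

Local Open Scope ring_scope.
Local Open Scope classical_set_scope.

(* {malg R[G]} is the library's module of finitely supported functions G -> R.
   Its ring structure in monalg is restricted to monoids without non-trivial
   units, so the convolution ring of a group is built on an alias of it. *)
Definition group_ring (R : nzRingType) (G : groupType) := {malg R[G]}.

HB.instance Definition _ (R : nzRingType) (G : groupType) :=
  GRing.Zmodule.on (group_ring R G).

Section GroupRing.
Variables (R : nzRingType) (G : groupType).
Implicit Types x y z : group_ring R G.

Definition gr_one : group_ring R G := << 1 *g 1%g >>.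

Definition gr_mul x y : group_ring R G :=
  \sum_(g <- msupp x) \sum_(h <- msupp y) << x@_g * y@_h *g (g * h)%g >>.

Lemma gr_mulw (d1 d2 : {fset G}) x y :
    (msupp x `<=` d1)%fset -> (msupp y `<=` d2)%fset ->
  gr_mul x y = \sum_(g <- d1) \sum_(h <- d2) << x@_g * y@_h *g (g * h)%g >>.
Proof.
move=> le1 le2; rewrite /gr_mul (big_fset_incl _ le1) /=; last first.
  move=> g _ /mcoeff_outdom xg.
  by rewrite big1 // => h _; rewrite xg mul0r monalgU0.
apply: eq_bigr => g _; apply: big_fset_incl => // h _ /mcoeff_outdom ->.
by rewrite mulr0 monalgU0.
Qed.

Lemma gr_mulDl : left_distributive gr_mul +%R.
Proof.
move=> x y z; pose d := (msupp x `|` msupp y)%fset.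
rewrite (@gr_mulw d (msupp z) (x + y)) ?(msuppD_le, fsubset_refl) //.
rewrite (@gr_mulw d (msupp z) x) ?(fsubsetUl, fsubset_refl) //.
rewrite (@gr_mulw d (msupp z) y) ?(fsubsetUr, fsubset_refl) //.
rewrite -big_split /=; apply: eq_bigr => g _.
rewrite -big_split /=; apply: eq_bigr => h _.
by rewrite mcoeffD mulrDl monalgUD.
Qed.

Lemma gr_mulDr : right_distributive gr_mul +%R.
Proof.
move=> z x y; pose d := (msupp x `|` msupp y)%fset.
rewrite (@gr_mulw (msupp z) d z (x + y)) ?(msuppD_le, fsubset_refl) //.
rewrite (@gr_mulw (msupp z) d z x) ?(fsubsetUl, fsubset_refl) //.
rewrite (@gr_mulw (msupp z) d z y) ?(fsubsetUr, fsubset_refl) //.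
rewrite -big_split /=; apply: eq_bigr => g _.
rewrite -big_split /=; apply: eq_bigr => h _.
by rewrite mcoeffD mulrDr monalgUD.
Qed.

Lemma gr_mul0r : left_zero 0 gr_mul.
Proof. by move=> x; rewrite /gr_mul msupp0 big_seq_fset0. Qed.

Lemma gr_mulr0 : right_zero 0 gr_mul.
Proof. by move=> x; rewrite /gr_mul big1 // => g _; rewrite msupp0 big_seq_fset0. Qed.

Lemma gr_mulUU (a b : R) (g h : G) :
  gr_mul << a *g g >> << b *g h >> = << a * b *g (g * h)%g >>.
Proof. by rewrite (gr_mulw msuppU_le msuppU_le) !big_seq_fset1 !mcoeffUU. Qed.

Lemma gr_mul_suml (I : Type) (s : seq I) (F : I -> group_ring R G) y :
  gr_mul (\sum_(i <- s) F i) y = \sum_(i <- s) gr_mul (F i) y.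
Proof. exact: (big_morph (gr_mul^~ y) (fun u v => gr_mulDl u v y) (gr_mul0r y)). Qed.

Lemma gr_mul_sumr (I : Type) (s : seq I) (F : I -> group_ring R G) x :
  gr_mul x (\sum_(i <- s) F i) = \sum_(i <- s) gr_mul x (F i).
Proof. exact: (big_morph (gr_mul x) (gr_mulDr x) (gr_mulr0 x)). Qed.

Lemma gr_mul1r : left_id gr_one gr_mul.
Proof.
move=> x; rewrite (gr_mulw msuppU_le (fsubset_refl _)) big_seq_fset1.
rewrite [RHS]monalgE; apply: eq_bigr => g _.
by rewrite mcoeffUU mul1r mul1g.
Qed.

Lemma gr_mulr1 : right_id gr_one gr_mul.
Proof.
move=> x; rewrite (gr_mulw (fsubset_refl _) msuppU_le) [RHS]monalgE.
by apply: eq_bigr => g _; rewrite big_seq_fset1 mcoeffUU mulr1 mulg1.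
Qed.

Lemma gr_mulA : associative gr_mul.
Proof.
move=> x y z; rewrite [x]monalgE gr_mul_suml (gr_mul_suml _ _ y) (gr_mul_suml _ _ z).
apply: eq_bigr => g _; rewrite [y]monalgE (gr_mul_suml _ _ z).
rewrite 2!(gr_mul_sumr _ _ << x@_g *g g >>) (gr_mul_suml _ _ z).
apply: eq_bigr => h _; rewrite [z]monalgE (gr_mul_sumr _ _ << y@_h *g h >>).
rewrite (gr_mul_sumr _ _ << x@_g *g g >>) (gr_mul_sumr _ _ (gr_mul _ _)).
apply: eq_bigr => k _; by rewrite !gr_mulUU mulrA mulgA.
Qed.

Lemma gr_one_neq0 : gr_one != 0.
Proof. by rewrite monalgU_eq0 oner_eq0. Qed.

End GroupRing.

HB.instance Definition _ (R : nzRingType) (G : groupType) :=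
  GRing.Zmodule_isNzRing.Build (group_ring R G)
    (@gr_mulA R G) (@gr_mul1r R G) (@gr_mulr1 R G)
    (@gr_mulDl R G) (@gr_mulDr R G) (@gr_one_neq0 R G).

Section Rings.
Variable R : nzRingType.

(* Set-valued, since units of a bare nzRingType are not decidable *)
Definition unit_set : set R := [set u | exists v, v * u = 1 /\ u * v = 1].

Definition Delta : set R :=
  [set x | forall u, unit_set u -> unit_set (x + u)].

Definition sqrt_Delta : set R :=
  [set x | exists n : nat, (1 <= n)%N /\ Delta (x ^+ n)].

Definition USqrtDelta_ring : Prop :=
  forall a : R, ~ unit_set a ->
    exists u b : R, [/\ unit_set u, sqrt_Delta b & a = u * b].

Definition left_ideal (I : set R) : Prop :=
  [/\ I 0, forall x y, I x -> I y -> I (x + y) & forall a x, I x -> I (a * x)].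

Definition maximal_left_ideal (M : set R) : Prop :=
  [/\ left_ideal M, M <> setT &
      forall I, left_ideal I -> M `<=` I -> I <> setT -> I = M].

Definition jacobson_radical : set R := \bigcap_(M in maximal_left_ideal) M.

End Rings.

Arguments USqrtDelta_ring : clear implicits.
Arguments jacobson_radical : clear implicits.

Section Groups.
Variable G : groupType.
Local Open Scope group_scope.

Definition subgroup (H : set G) : Prop :=
  [/\ H 1, forall x y, H x -> H y -> H (x * y) & forall x, H x -> H x^-1].

Definition fin_generated (H : set G) : Prop :=
  exists s : seq G, H = smallest subgroup [set` s].

Definition locally_finite : Prop :=
  forall H : set G, subgroup H -> fin_generated H -> finite_set H.

Definition has_order (g : G) (n : nat) : Prop :=
  [/\ (0 < n)%N, g ^+ n = 1 & forall m, (0 < m < n)%N -> g ^+ m <> 1].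

Definition is_pgroup (p : nat) : Prop :=
  forall g : G, exists k : nat, has_order g (p ^ k)%N.

End Groups.

Arguments locally_finite : clear implicits.
Arguments is_pgroup : clear implicits.

(* Main.v *)
From HB Require Import structures.
From mathcomp Require Import all_boot all_algebra all_fingroup.
From mathcomp Require Import cyclic pgroup mxrepresentation mxabelem.
From mathcomp Require Import boolp classical_sets cardinality finmap monalg.
Require Import Defs.

(** The augmentation [eps : RG -> R] is a ring retraction, split by the
    embedding of the scalars, and everything turns on whether it is local, that
    is, whether an element with a unit image is itself a unit.

    A unit never lies in [Delta] (subtract it from itself and get 0), hence no
    power of a unit does. So if [RG] is a U-sqrt-Delta ring and [eps x] is a
    unit, [x] is a unit: otherwise [x = u b] with a power of [b] in [Delta], and
    then [eps b] is a unit with a power in [Delta(R)]. Conversely, if [eps] is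
    local, then [eps] detects membership in [Delta], and a factorisation
    [eps a = u b] lifts to [a = u (u^-1 a)], where [u^-1 a] has image [b]. Thus
    [RG] is a U-sqrt-Delta ring iff [R] is one and [eps] is local
    ([retract_USqrtDelta], [retraction_USqrtDelta_local],
    [local_retraction_USqrtDelta]), and what remains is to compare locality of
    [eps] with the condition that [G] is a p-group and [p] is in [J(R)].

    Necessity. The element [1 - g + g^2] has augmentation 1. If it has an
    inverse, the coefficients of the inverse along the powers of [g] satisfy a
    linear recurrence, which has no finitely supported solution when [g] has
    infinite order ([augmentation_local_torsion]). If [h <> 1] and [h ^ q = 1],
    put [s = 1 + h + ... + h^(q-1)]: the unit [1 + r (s - q)] multiplies [1 - h]
    to [(1 - h) (1 - r q)], since [s (1 - h) = 0], and comparing coefficients at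
    1 inverts [1 - r q], so [q] is in [J(R)] ([augmentation_local_jacobson]).
    Distinct primes cannot both lie in [J(R)], so one prime accounts for the
    orders of all elements.

    Sufficiency. Only a finite subgroup [H] is involved in a given element.
    A p-group acts unipotently in characteristic [p], so long products of
    elements [h - 1] are divisible by [p] in [RH] ([diff_prod_eventually_p]),
    hence so is a high power of any [y] in the augmentation ideal. By Nakayama's
    lemma for the finitely generated [R]-module [RH], every [1 - p z] is a unit
    ([nat_jacobson_quasiregular]); it factors as [1 - y] times a geometric sum,
    so [1 - y] is a unit. *)

Set Implicit Arguments.
Unset Strict Implicit.
Unset Printing Implicit Defensive.

Import GRing.Theory.

Local Open Scope ring_scope.

(** * Units and the Jacobson radical *)

Section Units.
Variable R : nzRingType.
Implicit Types u v x : R.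

Lemma unit_set1 : @unit_set R 1.
Proof. by exists 1; rewrite mulr1. Qed.

Lemma unit_setM u v : unit_set u -> unit_set v -> unit_set (u * v).
Proof.
move=> [u' [u'u uu']] [v' [v'v vv']]; exists (v' * u'); split.
  by rewrite mulrA -(mulrA v') u'u mulr1.
by rewrite mulrA -(mulrA u) vv' mulr1.
Qed.

Lemma unit_setX u n : unit_set u -> unit_set (u ^+ n).
Proof.
by move=> uU; elim: n => [|n IHn]; rewrite ?exprS; [exact: unit_set1 | exact: unit_setM].
Qed.

Lemma unit_set_mull u v : unit_set u -> unit_set (u * v) -> unit_set v.
Proof.
move=> [u' [u'u uu']] uvU; rewrite -[v]mul1r -u'u -mulrA.
by apply: unit_setM => //; exists u; rewrite uu' u'u.
Qed.

(** Adding the unit [- x] to [x] would have to give a unit. *)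
Lemma Delta_nonunit x : Delta x -> ~ unit_set x.
Proof.
move=> Dx [v [vx xv]].
have [|w [_]] := Dx (- x); first by exists (- v); rewrite !mulrNN.
by rewrite subrr mul0r => /eqP; rewrite eq_sym oner_eq0.
Qed.

(** If [t (1 - x) = 1] and [1 - t] is again of the kind considered, then [t]
    has a left inverse too; being left and right invertible, [t] is a unit with
    inverse [1 - x]. *)
Lemma left_quasiregular_unit (P : R -> Prop) :
    (forall x, P x -> exists2 t, t * (1 - x) = 1 & P (1 - t)) ->
  forall x, P x -> unit_set (1 - x).
Proof.
move=> Pinv x Px; have [t tx Pt] := Pinv x Px; exists t; split=> //.
have [y yt _] := Pinv _ Pt.
rewrite subKr in yt.
by have <- : y = 1 - x by rewrite -[LHS]mulr1 -[X in _ * X]tx mulrA yt mul1r.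
Qed.

End Units.

Lemma rmorph_unit_set (R S : nzRingType) (f : {rmorphism R -> S}) x :
  unit_set x -> unit_set (f x).
Proof. by move=> [y [yx xy]]; exists (f y); rewrite -!rmorphM yx xy rmorph1. Qed.

Section Jacobson.
Variable R : nzRingType.
Implicit Types (a r x : R) (I M : set R).
Local Open Scope classical_set_scope.

Lemma proper_left_ideal I : left_ideal I -> (I <> setT) <-> ~ I 1.
Proof.
move=> [_ _ IM]; split=> [IT I1 | I1 IT]; last by apply: I1; rewrite IT.
by apply: IT; apply/seteqP; split=> // r _; rewrite -[r]mulr1; apply: IM.
Qed.

(** Zorn's lemma. The order is taken on the sets [X] for which [X `|` I] is a
    proper left ideal, rather than on the ideals above [I], so that the empty
    chain has the union [set0] as an upper bound and needs no separate case. *)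
Lemma exists_maximal_left_ideal I : left_ideal I -> ~ I 1 ->
  exists2 M, maximal_left_ideal M & I `<=` M.
Proof.
move=> LI I1; pose P X := left_ideal (X `|` I) /\ ~ (X `|` I) 1.
have [F FP totF | M [[LM M1] Mmax]] := @Zorn_bigcup R P.
  have chain X Y x y : F X -> F Y -> (X `|` I) x -> (Y `|` I) y ->
      exists Z, [/\ F Z, (Z `|` I) x & (Z `|` I) y].
    move=> FX FY Xx Yy; have [XY|YX] := totF _ _ FX FY.
      by exists Y; split=> //; apply: setSU Xx.
    by exists X; split=> //; apply: setSU Yy.
  have toF Z : F Z -> Z `|` I `<=` \bigcup_(X in F) X `|` I.
    by move=> FZ; apply: setSU => z Zz; exists Z.
  have ofF x : (\bigcup_(X in F) X `|` I) x ->
      I x \/ exists2 X, F X & (X `|` I) x.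
    by move=> [[X FX Xx]|]; [right; exists X => //; left | left].
  case: (LI) => I0 ID IM; split; last first.
    by move=> /ofF[//|[X FX X1]]; case: (FP _ FX).
  split=> [|x y|a x]; first by right.
  - move=> /ofF[Ix|[X FX Xx]] /ofF[Iy|[Y FY Yy]].
    + by right; apply: ID.
    + have [[_ YD _] _] := FP _ FY.
      by apply: (toF _ FY); apply: YD => //; right.
    + have [[_ XD _] _] := FP _ FX.
      by apply: (toF _ FX); apply: XD => //; right.
    have [Z [FZ Zx Zy]] := chain _ _ _ _ FX FY Xx Yy.
    have [[_ ZD _] _] := FP _ FZ.
    by apply: (toF _ FZ); apply: ZD.
  - move=> /ofF[Ix|[X FX Xx]]; first by right; apply: IM.
    have [[_ _ XM] _] := FP _ FX.
    by apply: (toF _ FX); apply: XM.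
exists (M `|` I); last exact: subsetUr.
split=> //; first by apply/proper_left_ideal.
move=> K LK MK /(proper_left_ideal LK) K1; apply/seteqP; split=> //.
apply: contrapT => KM.
have KI : K `|` I = K by apply: setUidl; apply: subset_trans MK; exact: subsetUr.
apply: (Mmax K); last by rewrite /P KI.
split; first by apply: subset_trans MK; exact: subsetUl.
by move=> KM'; apply: KM => x Kx; left; apply: KM'.
Qed.

(** The elementwise description of the radical: a left ideal generated by
    [1 - r * a] that is proper sits in a maximal left ideal [M], which cannot
    contain [a]; and if [a] misses [M], then [1] is in [M + R a]. *)
Lemma jacobson_radicalP a :
  jacobson_radical R a <-> (forall r, exists t, t * (1 - r * a) = 1).
Proof.
split=> [Ja r | inva M MM].
  apply: contrapT => noinv.
  pose I := [set x : R | exists t, x = t * (1 - r * a)].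
  have LI : left_ideal I.
    split=> [|_ _ [t ->] [t' ->]|b _ [t ->]]; first by exists 0; rewrite mul0r.
      by exists (t + t'); rewrite mulrDl.
    by exists (b * t); rewrite mulrA.
  have [[t t1]|M MM IM] := exists_maximal_left_ideal LI.
    by apply: noinv; exists t.
  case: (MM) => [[M0 MD Mmul] MT _].
  have LM : left_ideal M by [].
  apply: (proj1 (proper_left_ideal LM)) => //.
  rewrite -[1](subrK (r * a)); apply: MD; last by apply: Mmul; apply: Ja.
  by apply: IM; exists 1; rewrite mul1r.
apply: contrapT => Ma; case: MM => [[M0 MD Mmul] MT Mmax].
have LM : left_ideal M by [].
pose K := [set x : R | exists m r, M m /\ x = m + r * a].
have LK : left_ideal K.
  split=> [|_ _ [m [r [Mm ->]]] [n [s [Mn ->]]]|b _ [m [r [Mm ->]]]].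
  - by exists 0, 0; rewrite mul0r addr0.
  - exists (m + n), (r + s); split; first exact: MD.
    by rewrite mulrDl addrACA.
  - exists (b * m), (b * r); split; first exact: Mmul.
    by rewrite mulrDr mulrA.
have MK : M `<=` K by move=> m Mm; exists m, 0; rewrite mul0r addr0.
have [K1|K1] := pselect (K 1); last first.
  apply: Ma; rewrite -(Mmax K LK MK); last by apply/proper_left_ideal.
  by exists 0, 1; rewrite mul1r add0r.
case: K1 => m [r [Mm m1]]; have [t t1] := inva r.
apply: (proj1 (proper_left_ideal LM)) => //.
by rewrite -t1 m1 addrK; apply: Mmul.
Qed.

Lemma jacobson_radicalD x y :
  jacobson_radical R x -> jacobson_radical R y -> jacobson_radical R (x + y).
Proof.
by move=> Jx Jy M MM; case: (MM) => [[_ MD _] _ _]; apply: MD; [apply: Jx|apply: Jy].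
Qed.

Lemma jacobson_radicalM r x : jacobson_radical R x -> jacobson_radical R (r * x).
Proof. by move=> Jx M MM; case: (MM) => [[_ _ Mm] _ _]; apply: Mm; apply: Jx. Qed.

Lemma jacobson_radical1 : ~ jacobson_radical R 1.
Proof.
move=> /jacobson_radicalP/(_ 1)[t].
by rewrite mulr1 subrr mulr0 => /eqP; rewrite eq_sym oner_eq0.
Qed.

(** Nakayama's lemma, in the form [V = M + J V] implies [V = M], for a module
    generated by finitely many [v i]. The generators are removed one at a time:
    in the expression for [v i] itself the coefficient [c i * a] of [v i] can be
    moved to the left, where [1 - c i * a] is left invertible. *)
Lemma nakayama (V : lmodType R) (I : Type) (v : I -> V) (s : seq I) a
    (M : V -> Prop) :
    jacobson_radical R a ->
    (forall y z, M y -> M z -> M (y + z)) -> (forall r z, M z -> M (r *: z)) ->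
    (forall z, exists2 m, M m &
       exists c : I -> R, z = m + \sum_(i <- s) (c i * a) *: v i) ->
  forall z, M z.
Proof.
move=> /jacobson_radicalP Ja MD MZ; elim: s => [|i s IHs] gen.
  by move=> z; have [m Mm [c ->]] := gen z; rewrite big_nil addr0.
apply: IHs => z.
have [m Mm [c]] := gen (v i); rewrite big_cons => vi.
have [u u1] := Ja (c i).
have {}vi : v i = u *: m + \sum_(j <- s) (u * c j * a) *: v j.
  rewrite -{1}[v i]scale1r -u1 -scalerA scalerBl scale1r {1}vi.
  rewrite addrCA addrAC subrr add0r scalerDr scaler_sumr.
  by congr (_ + _); apply: eq_bigr => j _; rewrite scalerA mulrA.
have [n Mn [d ->]] := gen z; rewrite big_cons vi.
exists (n + (d i * a * u) *: m); first by apply: MD => //; apply: MZ.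
exists (fun j => d i * a * u * c j + d j).
rewrite scalerDr scalerA scaler_sumr !addrA -addrA; congr (_ + _).
rewrite -big_split /=; apply: eq_bigr => j _.
by rewrite scalerA -scalerDl mulrDl !mulrA.
Qed.

(** By Bezout, two coprime integers in the radical would put [1] in it. *)
Lemma jacobson_prime_uniq p q : prime p -> prime q ->
  jacobson_radical R p%:R -> jacobson_radical R q%:R -> p = q.
Proof.
move=> p_pr q_pr Jp Jq; apply: contrapT => pq.
have cop : coprime p q by rewrite prime_coprime // dvdn_prime2 //; apply/eqP.
have [[|a] b ab _] := egcdnP q (prime_gt0 p_pr).
  by move: ab; rewrite mul0n => /esym/eqP; rewrite addn_eq0 (eqP cop) andbF.
apply: jacobson_radical1.
have -> : 1 = (a.+1)%:R * p%:R + (- b%:R) * q%:R :> R.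
  by rewrite mulNr -!natrM ab (eqP cop) natrD addrAC subrr add0r.
by apply: jacobson_radicalD; apply: jacobson_radicalM.
Qed.

End Jacobson.

(** * The U-sqrt-Delta property along ring retractions *)

Section Retract.
Variables (R S : nzRingType) (f : {rmorphism S -> R}) (i : {rmorphism R -> S}).
Hypothesis iK : cancel i f.

Lemma retract_Delta x : Delta x -> Delta (f x).
Proof.
move=> Dx u /(rmorph_unit_set i)/Dx/(rmorph_unit_set f).
by rewrite rmorphD iK.
Qed.

Lemma retract_sqrt_Delta x : sqrt_Delta x -> sqrt_Delta (f x).
Proof.
by move=> [n [n0 Dx]]; exists n; split=> //; rewrite -rmorphXn; apply: retract_Delta.
Qed.

Lemma retract_USqrtDelta : USqrtDelta_ring S -> USqrtDelta_ring R.
Proof.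
move=> US a aN.
have [|u [b [uU bD ab]]] := US (i a).
  by move=> /(rmorph_unit_set f); rewrite iK.
exists (f u), (f b); split; [exact: rmorph_unit_set | exact: retract_sqrt_Delta |].
by rewrite -rmorphM -ab iK.
Qed.

(** If [x = u * b] with a power of [b] in [Delta] and [f x] is a unit, then
    [f b] is a unit with a power in [Delta], which is absurd. *)
Lemma retraction_USqrtDelta_local : USqrtDelta_ring S ->
  forall x, unit_set (f x) -> unit_set x.
Proof.
move=> US x fxU; apply: contrapT => xN.
have [u [b [uU /retract_sqrt_Delta[n [_ Dfb]] xub]]] := US x xN.
apply: (Delta_nonunit Dfb); apply: unit_setX.
by apply: (@unit_set_mull _ (f u)); [exact: rmorph_unit_set | rewrite -rmorphM -xub].
Qed.

(** A factorisation [f a = u * b] lifts to [a = i u * (i u^-1 * a)]; the second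
    factor has image [b], and for a local [f] that is enough to place its power
    in [Delta]. *)
Lemma local_retraction_USqrtDelta : (forall x, unit_set (f x) -> unit_set x) ->
  USqrtDelta_ring R -> USqrtDelta_ring S.
Proof.
move=> floc UR a aN.
have [|u [b [uU [n [n0 bD]] fab]]] := UR (f a); first by move=> /floc.
have [u' [u'u uu']] := uU.
exists (i u), (i u' * a); split; first exact: rmorph_unit_set.
  exists n; split=> // w wU; apply: floc.
  rewrite rmorphD rmorphXn rmorphM iK fab mulrA u'u mul1r.
  by apply: bD; apply: rmorph_unit_set.
by rewrite mulrA -rmorphM uu' rmorph1 mul1r.
Qed.

End Retract.

(** * Homomorphisms out of a group ring *)

(** The left [R]-module structure is what Nakayama's lemma is applied to. *)
HB.instance Definition _ (R : nzRingType) (G : groupType) :=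
  GRing.Zmodule_isLmodule.Build R (group_ring R G)
    (@fgscaleA _ _) (@fgscale1r _ _) (@fgscaleDr _ _) (@fgscaleDl _ _).

Section GroupRingTheory.
Variables (R : nzRingType) (G : groupType).
Implicit Types (a r : R) (g h k : G) (x y : group_ring R G).

Definition gr_elt a g : group_ring R G := << a *g g >>.

Lemma gr_eltM a b g h : gr_elt a g * gr_elt b h = gr_elt (a * b) (g * h)%g.
Proof. exact: gr_mulUU. Qed.

Lemma gr_elt_is_additive g : additive (gr_elt^~ g).
Proof. by move=> a b; rewrite /gr_elt monalgUB. Qed.

Lemma gr_expand x : x = \sum_(g <- msupp x) gr_elt x@_g g.
Proof. exact: monalgE. Qed.

Lemma mcoeff_eltM a g x k : (gr_elt a g * x)@_k = a * x@_(g^-1 * k)%g.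
Proof.
rewrite {1}[x]gr_expand mulr_sumr raddf_sum [x in RHS]gr_expand raddf_sum mulr_sumr.
apply: eq_bigr => h _ /=; rewrite gr_eltM /gr_elt !mcoeffU -mulrnAr.
by rewrite -(inj_eq (mulgI g^-1%g)) mulKg.
Qed.

Lemma mcoeff_Melt a g x k : (x * gr_elt a g)@_k = x@_(k * g^-1)%g * a.
Proof.
rewrite {1}[x]gr_expand mulr_suml raddf_sum [x in RHS]gr_expand raddf_sum mulr_suml.
apply: eq_bigr => h _ /=; rewrite gr_eltM /gr_elt !mcoeffU -mulrnAl.
by rewrite -(inj_eq (mulIg g^-1%g)) mulgK.
Qed.

Lemma gr_scaleE r x : r *: x = gr_elt r 1%g * x.
Proof. by apply/malgP => k; rewrite mcoeff_eltM mcoeffZ invg1 mul1g. Qed.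

Lemma gr_scaleAl r x y : r *: (x * y) = r *: x * y.
Proof. by rewrite !gr_scaleE mulrA. Qed.

Definition gr_scalar r : group_ring R G := gr_elt r 1%g.

Lemma gr_scalar_is_additive : additive gr_scalar.
Proof. exact: gr_elt_is_additive. Qed.

Lemma gr_scalar_is_monoid_morphism : monoid_morphism gr_scalar.
Proof. by split=> // a b; rewrite /gr_scalar gr_eltM mulg1. Qed.

HB.instance Definition _ :=
  GRing.isAdditive.Build R (group_ring R G) gr_scalar gr_scalar_is_additive.
HB.instance Definition _ :=
  GRing.isMonoidMorphism.Build R (group_ring R G) gr_scalar
    gr_scalar_is_monoid_morphism.

End GroupRingTheory.

(** The universal property of [RG]: a ring morphism on [R] and a multiplicative
    map on [G] whose images commute extend to a ring morphism. Both the
    augmentation and the functoriality in [G] are instances of it. *)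
Section GroupRingLift.
Variables (R : nzRingType) (G : groupType) (T : nzRingType).
Variables (sigma : {rmorphism R -> T}) (tau : G -> T).

Definition gr_compatible : Prop :=
  [/\ tau 1%g = 1, {morph tau : g h / (g * h)%g >-> g * h} &
      forall r g, sigma r * tau g = tau g * sigma r].

(** The compatibility proof is an argument so that the ring morphism structure
    can be inferred from the term. *)
Definition gr_lift of gr_compatible := fun x : group_ring R G =>
  \sum_(g <- msupp x) sigma x@_g * tau g.

Hypothesis compat : gr_compatible.
Local Notation lift := (gr_lift compat).

Lemma gr_liftE (d : {fset G}) (x : group_ring R G) :
  (msupp x `<=` d)%fset -> lift x = \sum_(g <- d) sigma x@_g * tau g.
Proof.
move=> xd; apply: big_fset_incl => // g _ /mcoeff_outdom ->.
by rewrite rmorph0 mul0r.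
Qed.

Lemma gr_lift_elt a g : lift (gr_elt a g) = sigma a * tau g.
Proof. by rewrite (gr_liftE msuppU_le) big_seq_fset1 mcoeffUU. Qed.

Lemma gr_lift_is_additive : additive lift.
Proof.
move=> x y; pose d := (msupp x `|` msupp y)%fset.
rewrite (gr_liftE (msuppB_le x y)) (gr_liftE (fsubsetUl _ (msupp y))).
rewrite (gr_liftE (fsubsetUr (msupp x) _)) -sumrB.
by apply: eq_bigr => g _; rewrite mcoeffB rmorphB mulrBl.
Qed.

HB.instance Definition _ :=
  GRing.isAdditive.Build (group_ring R G) T lift gr_lift_is_additive.

Lemma gr_lift_is_monoid_morphism : monoid_morphism lift.
Proof.
have [tau1 tauM st] := id compat.
split=> [|x y]; first by rewrite gr_lift_elt tau1 rmorph1 mulr1.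
rewrite [x in LHS]gr_expand [y in LHS]gr_expand mulr_suml raddf_sum.
rewrite [lift x]/gr_lift mulr_suml; apply: eq_bigr => g _.
rewrite mulr_sumr raddf_sum [lift y]/gr_lift mulr_sumr; apply: eq_bigr => h _.
rewrite /= gr_eltM gr_lift_elt rmorphM tauM -!mulrA.
by rewrite [sigma _ * (tau _ * _)]mulrA st !mulrA.
Qed.

HB.instance Definition _ :=
  GRing.isMonoidMorphism.Build (group_ring R G) T lift gr_lift_is_monoid_morphism.

End GroupRingLift.

Section Augmentation.
Variables (R : nzRingType) (G : groupType).

Lemma augmentation_compatible :
  gr_compatible (idfun : R -> R) (fun _ : G => 1).
Proof. by split=> [|g h|r g]; rewrite ?mulr1 ?mul1r. Qed.

Definition augmentation : {rmorphism group_ring R G -> R} :=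
  gr_lift augmentation_compatible.

Lemma augmentation_elt a g : augmentation (gr_elt a g) = a.
Proof. by rewrite /augmentation /= gr_lift_elt mulr1. Qed.

Lemma augmentation_scalarK : cancel (@gr_scalar R G) augmentation.
Proof. by move=> a; rewrite /gr_scalar augmentation_elt. Qed.

End Augmentation.

Arguments augmentation {R G}.

Section GroupRingMap.
Variables (R : nzRingType) (H G : groupType) (phi : H -> G).
Hypotheses (phi1 : phi 1%g = 1%g) (phiM : {morph phi : g h / (g * h)%g}).

Lemma gr_map_compatible : gr_compatible (@gr_scalar R G) (fun h => gr_elt 1 (phi h)).
Proof.
split=> [|g h|r g]; first by rewrite phi1.
  by rewrite gr_eltM mul1r phiM.
by rewrite !gr_eltM mul1r mulr1 mul1g mulg1.
Qed.

Definition gr_map : {rmorphism group_ring R H -> group_ring R G} :=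
  gr_lift gr_map_compatible.

Lemma gr_map_elt a h : gr_map (gr_elt a h) = gr_elt a (phi h).
Proof. by rewrite /gr_map /= gr_lift_elt gr_eltM mulr1 mul1g. Qed.

End GroupRingMap.

(** * Group rings with local augmentation *)

Lemma eventually_notin (T : eqType) (s : seq T) (e : nat -> T) :
  injective e -> exists N, forall n, (N <= n)%N -> e n \notin s.
Proof.
move=> e_inj; elim: s => [|x s [N IHs]]; first by exists 0%N.
have [[m em]|noe] := pselect (exists m, e m = x).
  exists (maxn N m.+1) => n; rewrite geq_max => /andP[/IHs ens mn].
  by rewrite inE negb_or ens andbT -em (inj_eq e_inj) neq_ltn mn orbT.
exists N => n /IHs ens; rewrite inE negb_or ens andbT.
by apply/eqP => enx; apply: noe; exists n.
Qed.

(** The recurrence determines each term from the next two, so zeros propagate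
    backwards. *)
Lemma backward_recurrence_eq0 (V : zmodType) (b : nat -> V) N :
    (forall n, b n = b n.+1 - b n.+2) -> (forall n, (N <= n)%N -> b n = 0) ->
  forall n, b n = 0.
Proof.
move=> bE; elim: N => [b0 n|N IHN b0]; first exact: b0.
apply: IHN => n; rewrite leq_eqVlt => /predU1P[<-|]; last exact: b0.
by rewrite bE !b0 ?subrr // leqW.
Qed.

Lemma torsion_has_order (G : groupType) (g : G) :
  (exists2 n, (0 < n)%N & (g ^+ n = 1)%g) -> exists m, has_order g m.
Proof.
move=> [n n0 gn].
have ex : exists n, (0 < n)%N && (g ^+ n == 1)%g by exists n; rewrite n0 gn /=.
case: (ex_minnP ex) => m /andP[m0 /eqP gm] min_m; exists m; split=> // k /andP[k0 km] gk.
by have := min_m k; rewrite k0 gk eqxx leqNgt km => /(_ isT).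
Qed.

Section AugmentationLocal.
Variables (R : nzRingType) (G : groupType).

(** Equivalently, the augmentation ideal consists of quasi-regular elements. *)
Hypothesis aug_local :
  forall x : group_ring R G, unit_set (augmentation x) -> unit_set x.

(** Let [v] be an inverse of [1 - g + g^2] and let [g] have infinite order.
    Comparing coefficients along the powers of [g], [v] satisfies a recurrence
    that is homogeneous except at [1]. As [v] has finite support, going down from
    the large positive powers kills the coefficients at [g^n] for [n >= 0], and
    going up from the large negative powers kills those at [g^-n] for [n > 0];
    but the recurrence at [1] says that one of them is nonzero. *)
Lemma augmentation_local_torsion (g : G) :
  exists2 n, (0 < n)%N & (g ^+ n = 1)%g.
Proof.
apply: contrapT => free.
have gN n : (0 < n)%N -> (g ^+ n)%g <> 1%g by move=> n0 gn; apply: free; exists n.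
have g_inj : injective (fun n => (g ^+ n)%g).
  move=> m n; wlog mn : m n / (m <= n)%N => [wl|].
    by have [/wl//|/ltnW/wl wl' /esym/wl' ->] := leqP m n.
  move=> /eqP; rewrite -{1}(subnKC mn) expgD -{1}[(g ^+ m)%g]mulg1.
  rewrite (inj_eq (mulgI _)) => /eqP/esym gmn.
  apply/eqP; rewrite eqn_leq mn /= -subn_eq0.
  by case: posnP => // /gN.
have gV_inj : injective (fun n => (g ^- n)%g).
  by move=> m n /invg_inj/g_inj.
pose x : group_ring R G := gr_elt 1 1%g - gr_elt 1 g + gr_elt 1 (g * g)%g.
have [|v [_ xv]] := aug_local (x := x).
  rewrite rmorphD rmorphB !augmentation_elt subrr add0r.
  exact: unit_set1.
have rec k : v@_k - v@_(g^-1 * k)%g + v@_(g^-1 * (g^-1 * k))%g = (1%g == k)%:R.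
  have /(congr1 (mcoeff k)) := xv.
  rewrite mulrDl mulrBl mcoeffD mcoeffB !mcoeff_eltM !mul1r invg1 mul1g.
  by rewrite invMg -mulgA => ->; rewrite mcoeffU.
have zero e : injective e -> exists N, forall n, (N <= n)%N -> v@_(e n) = 0.
  move=> /(eventually_notin (msupp v))[N eN]; exists N => n /eN.
  exact: mcoeff_outdom.
have b0 n : v@_(g ^+ n)%g = 0.
  have [N bN] := zero _ g_inj; move: n.
  apply: (backward_recurrence_eq0 _ bN) => n.
  have := rec (g ^+ n.+2)%g; rewrite !expgS !mulKg.
  case: eqP => [/esym gn2|_ /eqP]; first by case: (gN n.+2); rewrite // !expgS.
  by rewrite addrAC subr_eq0 => /eqP <-; rewrite addrC addrK.
have c0 n : v@_(g ^- n.+1)%g = 0.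
  have [|N bN] := zero (fun n => g ^- n.+1)%g; first by move=> i j /gV_inj[].
  move: n; apply: (backward_recurrence_eq0 _ bN) => n.
  have := rec (g ^- n.+1)%g; rewrite -!invMg -!expgSr.
  case: eqP => [/esym/eqP|_ /eqP].
    by rewrite invg_eq1 => /eqP/(gN n.+1 isT).
  by rewrite mulr0n -addrA addr_eq0 opprD opprK addrC => /eqP ->; rewrite addrC.
have := rec 1%g; rewrite eqxx mulg1 -invMg.
have := b0 0%N; rewrite expg0 => ->.
have := c0 0%N; rewrite expg1 => ->.
have := c0 1%N; rewrite expgS expg1 => ->.
by rewrite subrr addr0 => /eqP; rewrite eq_sym oner_eq0.
Qed.

(** With [s] the sum of the powers of [h], the element [w = 1 + r * (s - q)] has
    augmentation 1, and [w * (1 - h) = (1 - h) * (1 - r * q)] as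
    [s * (1 - h) = 0]. A left inverse [v] of [w] then gives
    [v * (1 - h) * (1 - r * q) = 1 - h], whose coefficient at the identity
    exhibits a left inverse of [1 - r * q]. *)
Lemma augmentation_local_jacobson (h : G) q :
  h <> 1%g -> (h ^+ q = 1)%g -> jacobson_radical R q%:R.
Proof.
move=> h1 hq; apply/jacobson_radicalP => r.
pose y : group_ring R G := gr_elt 1 h.
have yX n : y ^+ n = gr_elt 1 (h ^+ n)%g.
  by elim: n => // n IHn; rewrite exprS IHn gr_eltM mul1r -expgS.
pose s := \sum_(i < q) y ^+ i.
have sy : s * (1 - y) = 0.
  have -> : s * (1 - y) = (1 - y) * s.
    apply/commr_sym/commr_sum => i _; apply: commrX.
    by apply/commr_sym; apply: commrB; [exact: commr1 | exact: commr_refl].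
  by rewrite -[1 - y]opprB mulNr -subrX1 yX hq subrr oppr0.
have augs : augmentation s = q%:R.
  rewrite raddf_sum (eq_bigr (fun _ => 1)) => [|i _].
    by rewrite sumr_const card_ord.
  by rewrite yX; exact: augmentation_elt.
pose w := 1 + gr_scalar G r * (s - q%:R).
have [|v [vw _]] := aug_local (x := w).
  rewrite rmorphD rmorphM rmorphB rmorph1 rmorph_nat augs subrr mulr0 addr0.
  exact: unit_set1.
have scalarC a : gr_scalar G a * (1 - y) = (1 - y) * gr_scalar G a.
  by rewrite mulrBl mulrBr mul1r mulr1 !gr_eltM mulr1 mul1r mul1g mulg1.
have wy : w * (1 - y) = (1 - y) * gr_scalar G (1 - r * q%:R).
  rewrite -scalarC rmorphB rmorph1 rmorphM rmorph_nat.
  by rewrite mulrDl mul1r -mulrA mulrBl sy sub0r mulrN mulrBl mul1r mulrA.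
exists (v * (1 - y))@_1%g.
have /(congr1 (mcoeff 1%g)) : v * (1 - y) * gr_scalar G (1 - r * q%:R) = 1 - y.
  by rewrite -mulrA -wy mulrA vw mul1r.
rewrite mcoeff_Melt invg1 mulg1 => ->.
rewrite mcoeffB !mcoeffU eqxx (introF eqP h1) mulr0n subr0.
by [].
Qed.

(** The power [g ^ (m / q)] is a nontrivial element killed by [q]. *)
Lemma has_order_prime_jacobson (g : G) m q :
  has_order g m -> prime q -> (q %| m)%N -> jacobson_radical R q%:R.
Proof.
move=> [m0 gm min_m] q_pr q_m.
apply: (@augmentation_local_jacobson (g ^+ (m %/ q))%g).
  by apply: min_m; rewrite divn_gt0 ?prime_gt0 // dvdn_leq //= ltn_Pdiv ?prime_gt1.
by rewrite -expgM divnK.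
Qed.

Lemma augmentation_local_pgroup : (exists g : G, g <> 1%g) ->
  exists p, [/\ prime p, is_pgroup G p & jacobson_radical R p%:R].
Proof.
have ord (g : G) : exists m, has_order g m.
  by apply: torsion_has_order; exact: augmentation_local_torsion.
move=> [g0 g0N]; have [m0 om0] := ord g0.
have m0_gt1 : (1 < m0)%N.
  case: om0 => m0_gt0 gm0 _; rewrite ltn_neqAle m0_gt0 andbT.
  by apply: contra_notN g0N => /eqP m01; rewrite -gm0 -m01 expg1.
have p_pr := pdiv_prime m0_gt1.
have Jp := has_order_prime_jacobson om0 p_pr (pdiv_dvd m0).
exists (pdiv m0); split=> // g; have [m om] := ord g.
have [m_gt0 _ _] := om.
have /p_natP[k mk] : (pdiv m0).-nat m.
  apply/pnatP => // q q_pr q_m; rewrite inE /=; apply/eqP.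
  exact: jacobson_prime_uniq (has_order_prime_jacobson om q_pr q_m) Jp.
by exists k; rewrite -mk.
Qed.

End AugmentationLocal.

(** * Finite p-groups *)

(** A p-group acting on a nonzero vector space of characteristic [p] has a
    nonzero fixed vector; by induction on the dimension, the action on the
    quotient by the fixed vectors is unipotent, and one more difference
    [w g - w] kills what is left. *)
Lemma unipotent_pgroup_repr (F : fieldType) p (gT : finGroupType)
    (G : {group gT}) n (rG : mx_representation F G n) (t : seq gT) :
    p \in [pchar F] -> (p.-group G)%g -> all (mem G) t -> (n <= size t)%N ->
  forall v : 'rV_n, foldl (fun w g => w *m rG g - w) v t = 0.
Proof.
move=> pF pG; elim/ltn_ind: n => n IHn in rG t *.
have [n0|n_gt0] := posnP n; first by subst n => _ _ v; rewrite thinmx0.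
case/lastP: t => [_|t g]; first by rewrite leqNgt n_gt0.
rewrite all_rcons size_rcons => /andP[Gg Gt] nt v; rewrite -cats1 foldl_cat /=.
pose U := rfix_mx rG G; have Umod : mxmodule rG U := rfix_mx_module rG.
suff /rfix_mxP/(_ g Gg) -> : (foldl (fun w g => w *m rG g - w) v t <= U)%MS.
  by rewrite subrr.
rewrite -in_factmod_eq0.
have in_fold w : in_factmod U (foldl (fun w g => w *m rG g - w) w t) =
    foldl (fun w g => w *m factmod_repr Umod g - w) (in_factmod U w) t.
  elim: (t) Gt w => //= h t' IHt /andP[Gh Gt'] w.
  by rewrite IHt // raddfB /= in_factmodJ.
have U_neq0 : U != 0 by rewrite (rfix_pgroup_pchar pF).
have ltUn : (\rank (cokermx U) < n)%N.
  by rewrite mxrank_coker ltn_subrL n_gt0 lt0n mxrank_eq0 U_neq0.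
by rewrite in_fold IHn // -ltnS (leq_trans ltUn).
Qed.

Section FiniteGroup.
Variables (R : nzRingType) (gT : finGroupType) (p : nat).
Hypotheses (p_pr : prime p) (pG : (p.-group [set: gT])%g).
Local Notation S := (group_ring R gT).
Implicit Types (x y z : S) (g h : gT).

Lemma gr_expandT x : x = \sum_h x@_h *: gr_elt 1 h.
Proof.
apply/malgP => k; rewrite raddf_sum (bigD1 k) //= big1 => [|h hk].
  by rewrite mcoeffZ mcoeffUU mulr1 addr0.
by rewrite mcoeffZ mcoeffU (negPf hk) mulr0.
Qed.

Lemma augmentation_sum x : augmentation x = \sum_h x@_h.
Proof.
rewrite {1}[x]gr_expandT raddf_sum; apply: eq_bigr => h _.
by rewrite gr_scaleE gr_eltM mulr1 mul1g; exact: augmentation_elt.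
Qed.

(** Lifting ['F_p] to [R] through representatives in [nat] is additive up to
    multiples of [p]. *)
Lemma Fp_lift_add (a b d : 'F_p) : d + b = a ->
  exists c : R, d%:R = a%:R - b%:R + p%:R * c.
Proof.
move=> /(congr1 (@nat_of_ord _)) /=; rewrite [X in (_ %% X)%N]Fp_cast // => abE.
exists ((d + b) %/ p)%:R; rewrite -natrM mulnC; apply: (addIr b%:R).
rewrite -natrD {1}(divn_eq (d + b)%N p) abE natrD.
by rewrite addrAC subrK addrC.
Qed.

Definition diff_prod (t : seq gT) : S := \prod_(g <- t) (gr_elt 1 g - 1).

(** The augmentation ideal is nilpotent modulo [p]. Lifting the regular
    representation of [gT] over ['F_p] to [R[gT]] turns the action of [g] into
    multiplication by [g] and differences into differences modulo [p]; the
    iterated differences of the vector lifting to [1] vanish after [#|gT|]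
    steps. *)
Lemma diff_prod_eventually_p : exists N, forall t, (N <= size t)%N ->
  exists z, diff_prod t = p%:R * z.
Proof.
pose G := [set: gT]%G; pose rG := regular_repr 'F_p G.
pose idx (h : gT) := gring_index G h.
have idxK h : enum_val (idx h) = h by rewrite gring_indexK ?inE.
have idx_inj : injective idx by move=> g h gh; rewrite -[g]idxK gh idxK.
pose L (v : 'rV['F_p]_#|G|) : S := \sum_h (v 0 (idx h))%:R *: gr_elt 1 h.
have L_act v g : L (v *m rG g) = L v * gr_elt 1 g.
  rewrite /L mulr_suml (reindex_inj (mulIg g)) /=; apply: eq_bigr => h _.
  rewrite -gr_scaleAl gr_eltM mulr1; congr ((nat_of_ord _)%:R *: _).
  rewrite mxE (bigD1 (idx h)) //= big1 => [|i ih]; rewrite !mxE eqxx /=.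
    by rewrite idxK eqxx mulr1 addr0.
  rewrite (inj_eq idx_inj) (inj_eq (mulIg g)) -(inj_eq idx_inj) /idx gring_valK.
  by rewrite eq_sym (negPf ih) mulr0.
have L_sub (v w : 'rV['F_p]_#|G|) : exists z, L (v - w) = L v - L w + p%:R * z.
  have /fin_all_exists[c cP] h : exists c : R,
      (nat_of_ord ((v - w)%R 0%R (idx h)))%:R =
      (v 0 (idx h))%:R - (w 0 (idx h))%:R + p%:R * c.
    by apply: Fp_lift_add; rewrite !mxE subrK.
  exists (\sum_h c h *: gr_elt 1 h).
  rewrite /L mulr_sumr -sumrB -big_split; apply: eq_bigr => h _ /=.
  by rewrite cP scalerDl scalerBl -scalerA (scaler_nat p) mulr_natl.
have L_fold t v : exists z,
    L (foldl (fun w g => w *m rG g - w) v t) = L v * diff_prod t + p%:R * z.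
  elim: t v => [|g t IHt] v /=.
    by exists 0; rewrite /diff_prod big_nil mulr1 mulr0 addr0.
  have [z ->] := IHt (v *m rG g - v); have [c ->] := L_sub (v *m rG g) v.
  exists (c * diff_prod t + z).
  rewrite L_act /diff_prod big_cons mulrDl mulrBl mulrA mulrBr mulr1 mulrBl.
  by rewrite -addrA mulrDr mulrA.
have [v Lv] : exists v, L v = 1.
  exists (delta_mx 0 (idx 1%g)).
  rewrite /L (bigD1 1%g) //= big1 => [|h h1].
    by rewrite mxE !eqxx addr0 scale1r.
  by rewrite mxE (inj_eq idx_inj) (negPf h1) scale0r.
have L0 : L 0 = 0 by rewrite /L big1 // => h _; rewrite mxE scale0r.
exists #|G| => t tG; have [z] := L_fold t v.
rewrite (unipotent_pgroup_repr rG (pchar_Fp p_pr)) //; last first.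
  by apply/allP => g _; rewrite inE.
rewrite L0 Lv mul1r => /esym/eqP; rewrite addr_eq0 => /eqP ->.
by exists (- z); rewrite mulrN.
Qed.

(** Such a [y] is an [R]-combination of the elements [h - 1], and the scalars
    commute with these, so [y ^ N] is a combination of products of [N] such
    differences. *)
Lemma augmentation0_nilpotent_mod_p y : augmentation y = 0 ->
  exists N, exists z, y ^+ N = p%:R * z.
Proof.
move=> y0; have [N ND] := diff_prod_eventually_p; exists N.
have yE : y = \sum_h y@_h *: (gr_elt 1 h - 1).
  under eq_bigr do rewrite scalerBr.
  by rewrite sumrB -gr_expandT -scaler_suml -augmentation_sum y0 scale0r subr0.
have scalarC r t : gr_scalar gT r * diff_prod t = diff_prod t * gr_scalar gT r.
  apply: commr_prod => h _; apply: commrB; last exact: commr1.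
  by rewrite /GRing.comm !gr_eltM mulr1 mul1r mulg1 mul1g.
(* Trading factors of y for differences one at a time avoids expanding y ^ N. *)
suff key n t : (N <= size t + n)%N -> exists z, diff_prod t * y ^+ n = p%:R * z.
  have [z] := key N [::] (leqnn _).
  by rewrite /diff_prod big_nil mul1r => ->; exists z.
elim: n t => [|n IHn] t; first by rewrite addn0 mulr1 => /ND.
rewrite addnS -addSn => tn.
have /fin_all_exists[z zP] h := IHn (rcons t h) ltac:(by rewrite size_rcons).
exists (\sum_h y@_h *: z h).
rewrite exprS {1}yE mulr_suml !mulr_sumr; apply: eq_bigr => h _.
rewrite !gr_scaleE !mulrA -scalarC -!mulrA [_ * (_ * y ^+ n)]mulrA.
have := zP h; rewrite /diff_prod -cats1 big_cat big_seq1 /= => ->.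
by rewrite !mulr_natl mulrnAr.
Qed.

(** Writing [x = x (1 - p z) + p x z] shows that the left ideal generated by
    [1 - p z] is everything modulo [p], so Nakayama's lemma applies to it. *)
Lemma nat_jacobson_quasiregular z :
  jacobson_radical R p%:R -> unit_set (1 - p%:R * z).
Proof.
move=> Jp; pose P x := exists z, x = p%:R * z.
apply: (@left_quasiregular_unit _ P); last by exists z.
move=> _ [{}z ->]; suff [t t1] : exists t, 1 = t * (1 - p%:R * z).
  exists t => //; exists (- (t * z)).
  apply/eqP; rewrite subr_eq {1}t1 mulrBr mulr1 addrC.
  by rewrite !mulr_natl mulrnAr mulNrn.
apply: (@nakayama R S gT (gr_elt 1) (index_enum gT) p%:R
  (fun x => exists t, x = t * (1 - p%:R * z)) Jp) => [_ _ [t ->] [u ->]|r _ [t ->]|x].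
- by exists (t + u); rewrite mulrDl.
- by exists (r *: t); rewrite gr_scaleAl.
exists (x * (1 - p%:R * z)); first by exists x.
exists (fun h => (x * z)@_h).
under eq_bigr do rewrite mulr_natr -scalerMnl.
rewrite sumrMnl -gr_expandT mulrBr mulr1 mulr_natl mulrnAr.
by rewrite subrK.
Qed.

(** After scaling, [x = 1 - y] with [y] in the augmentation ideal; then
    [1 - y ^ N = 1 - p z] is a unit, and it is a multiple of [1 - y] on both
    sides. *)
Lemma finite_pgroup_augmentation_local x : jacobson_radical R p%:R ->
  unit_set (augmentation x) -> unit_set x.
Proof.
move=> Jp [v [vx xv]].
pose y := 1 - x * gr_scalar gT v.
have y0 : augmentation y = 0.
  by rewrite rmorphB rmorph1 rmorphM [X in _ * X]augmentation_elt xv subrr.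
have [N [z yN]] := augmentation0_nilpotent_mod_p y0.
have [w [wu uw]] := nat_jacobson_quasiregular z Jp.
pose s := \sum_(i < N) y ^+ i.
have ys : (1 - y) * s = 1 - p%:R * z.
  by rewrite -yN -[1 - y]opprB mulNr -subrX1 opprB.
have sy : s * (1 - y) = 1 - p%:R * z.
  rewrite -ys; apply/commr_sym/commr_sum => i _; apply: commrX.
  by apply/commr_sym; apply: commrB; [exact: commr1 | exact: commr_refl].
have yU : unit_set (1 - y).
  exists (s * w); split; last by rewrite mulrA ys uw.
  have -> : s * w = w * s.
    by rewrite -[LHS]mul1r -wu -sy -!mulrA [(1 - y) * _]mulrA ys uw mulr1.
  by rewrite -mulrA sy wu.
rewrite -[x]mulr1 -(rmorph1 (gr_scalar gT)) -vx rmorphM mulrA.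
rewrite -[x * _](subKr 1) -/y; apply: unit_setM => //.
exists (gr_scalar gT v); rewrite -!rmorphM.
by rewrite vx xv rmorph1.
Qed.

End FiniteGroup.

(** * Locally finite p-groups *)

(** By Cauchy's theorem any prime dividing the order of the group is the order
    of some element. *)
Lemma is_pgroup_fin (gT : finGroupType) p : prime p ->
  is_pgroup gT p -> (p.-group [set: gT])%g.
Proof.
move=> p_pr pG; apply/pgroupP => q q_pr /(Cauchy q_pr)[g _ og].
have [k [_ gk _]] := pG g.
have := order_dvdn g (p ^ k); rewrite gk eqxx og => qk.
by move: qk; rewrite Euclid_dvdX // dvdn_prime2 // inE => /andP[].
Qed.

Section FiniteSubgroup.
Variables (G : groupType) (D : {fset G}).

(** The closure proof is an argument so that the group structure can be
    inferred from the type. *)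
Definition fin_subgroup of group_closed (mem D) : Type := D.

Variable D_closed : group_closed (mem D).

HB.instance Definition _ := SubFinite.on (fin_subgroup D_closed).
HB.instance Definition _ :=
  SubChoice_isSubGroup.Build G (mem D) (fin_subgroup D_closed) D_closed.

Local Notation H := (fin_subgroup D_closed).

Lemma fin_subgroup_is_pgroup p : is_pgroup G p -> is_pgroup H p.
Proof.
move=> pG h; have valX n : val (h ^+ n)%g = (val h ^+ n)%g.
  by elim: n => [|n IHn]; rewrite ?expg0 ?val1 // !expgS valM IHn.
have [k [k0 hk min_k]] := pG (val h); exists k; split=> // [|m /min_k hm].
  by apply: val_inj; rewrite valX hk val1.
by move=> hm1; apply: hm; rewrite -valX hm1 val1.
Qed.

Definition fin_subgroup_map (R : nzRingType) :
    {rmorphism group_ring R H -> group_ring R G} :=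
  gr_map R (val1 H) (@valM _ _ H).

Lemma fin_subgroup_map_surj (R : nzRingType) (x : group_ring R G) :
  (msupp x `<=` D)%fset -> exists x', fin_subgroup_map R x' = x.
Proof.
move=> xD; exists (\sum_(h : H) gr_elt x@_(val h) h).
rewrite raddf_sum /= [RHS](monalgEw xD) big_seq_fsetE /=.
by apply: eq_bigr => h _; rewrite gr_map_elt.
Qed.

Lemma augmentation_fin_subgroup_map (R : nzRingType) (x : group_ring R H) :
  augmentation (fin_subgroup_map R x) = augmentation x.
Proof.
rewrite [x]gr_expand (raddf_sum (fin_subgroup_map R)) !(raddf_sum augmentation).
apply: eq_bigr => h _; rewrite [RHS]augmentation_elt -[RHS](augmentation_elt _ (val h)).
by congr (augmentation _); exact: gr_map_elt.
Qed.

End FiniteSubgroup.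

Lemma locally_finite_fset (G : groupType) (s : seq G) : locally_finite G ->
  exists2 D : {fset G}, group_closed (mem D) & {subset s <= D}.
Proof.
move=> lfG; pose H := smallest (@subgroup G) [set` s].
have [H1 HM HV] : subgroup H.
  split=> [A [[A1 _ _] _] //|x y Hx Hy A HA|x Hx A HA]; have [[_ AM AV] _] := HA.
    by apply: AM; [exact: Hx | exact: Hy].
  by apply: AV; exact: Hx.
have /finite_fsetP[D HD] : finite_set H by apply: (lfG H) => //; exists s.
have inD x : x \in D <-> H x by rewrite HD.
exists D => [|x xs]; last by apply/inD; apply: sub_gen_smallest.
split=> [|x y]; first exact/inD.
by move=> /inD Hx /inD Hy; apply/inD; exact: HM Hx (HV _ Hy).
Qed.

Lemma locally_finite_augmentation_local (R : nzRingType) (G : groupType) p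
    (x : group_ring R G) :
  locally_finite G -> prime p -> is_pgroup G p -> jacobson_radical R p%:R ->
  unit_set (augmentation x) -> unit_set x.
Proof.
move=> lfG p_pr pG Jp; have [D Dcl xD] := locally_finite_fset (msupp x) lfG.
have [x' <-] : exists x', fin_subgroup_map Dcl R x' = x.
  exact/fin_subgroup_map_surj/fsubsetP.
rewrite augmentation_fin_subgroup_map => augU; apply: rmorph_unit_set.
apply: finite_pgroup_augmentation_local Jp augU => //.
exact/is_pgroup_fin/fin_subgroup_is_pgroup.
Qed.

Theorem theorem4p3 (R : nzRingType) (G : groupType)
    (G_nontrivial : exists g : G, g <> 1%g) :
  (USqrtDelta_ring (group_ring R G) ->
     USqrtDelta_ring R /\
     exists p : nat,
       [/\ prime p, is_pgroup G p & jacobson_radical R (p%:R : R)])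
  /\
  (USqrtDelta_ring R -> locally_finite G ->
     (exists p : nat,
       [/\ prime p, is_pgroup G p & jacobson_radical R (p%:R : R)]) ->
     USqrtDelta_ring (group_ring R G)).
Proof.
have augK := @augmentation_scalarK R G; split=> [URG | UR lfG [p [p_pr pG Jp]]].
  split; first exact: retract_USqrtDelta augK URG.
  exact: augmentation_local_pgroup (retraction_USqrtDelta_local augK URG) G_nontrivial.
apply: local_retraction_USqrtDelta augK _ UR => x.
exact: locally_finite_augmentation_local p_pr pG Jp.
Qed.
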